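(* Let $A=(a_{ij})\in\mathbb{R}^{n\times n}$ (the crisp coefficient matrix of a fuzzy system of linear equations $Ax=b$), and let $S\in\mathbb{R}^{2n\times 2n}$ be the associated matrix $S=\begin{pmatrix} S_1 & S_2\\ S_2 & S_1\end{pmatrix}$, where $S_1=(\alpha_{ij})\in\mathbb{R}^{n\times n}$ has entries $\alpha_{ij}=a_{ij}$ if $a_{ij}>0$ and $\alpha_{ij}=0$ otherwise, and $S_2=A-S_1$. (a) If $A$ is strictly diagonally dominant, then there is a permutation matrix $P\in\mathbb{R}^{2n\times 2n}$ such that $PS$ is also strictly diagonally dominant. (b) If $A$ is strictly diagonally dominant with positive diagonal entries, then $S$ is also strictly diagonally dominant.
   Context: A square real matrix $B=(b_{ij})\in\mathbb{R}^{k\times k}$ is strictly diagonally dominant if $|b_{ii}|>\sum_{j\neq i}|b_{ij}|$ for every $i=1,\ldots,k$. A permutation matrix is a square matrix with exactly one $1$ in each row and each column and $0$s elsewhere. *)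

(* Defs.v *)
From mathcomp Require Import all_boot all_order all_algebra.
From mathcomp Require Import reals.
Set Implicit Arguments.
Unset Strict Implicit.
Unset Printing Implicit Defensive.
Import Order.TTheory GRing.Theory Num.Theory.
Local Open Scope ring_scope.

Definition strictly_diag_dominant (R : realType) (k : nat) (B : 'M[R]_k) : Prop :=
  forall i : 'I_k, \sum_(j < k | j != i) `|B i j| < `|B i i|.

Definition fuzzy_S1 (R : realType) (n : nat) (A : 'M[R]_n) : 'M[R]_n :=
  \matrix_(i, j) (if 0 < A i j then A i j else 0).

(* S2 keeps the nonpositive entries of A with their sign: it is A - S1, as
   opposed to the other common convention S1 - A. *)
Definition fuzzy_S2 (R : realType) (n : nat) (A : 'M[R]_n) : 'M[R]_n :=
  A - fuzzy_S1 A.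

Definition fuzzy_S (R : realType) (n : nat) (A : 'M[R]_n) : 'M[R]_(n + n) :=
  block_mx (fuzzy_S1 A) (fuzzy_S2 A) (fuzzy_S2 A) (fuzzy_S1 A).

(* Main.v *)
Require Import Defs.
From mathcomp Require Import all_boot all_order all_algebra.
From mathcomp Require Import perm reals.
Import Order.TTheory GRing.Theory Num.Theory.
Local Open Scope ring_scope.

(** Strict diagonal dominance of a row says that the sum of the absolute values
    of all its entries is less than twice that of its diagonal entry.  Each
    entry [a] of [A] is split in [S] into its positive part and its negative
    part, one of which is zero, so each of the two rows of [S] coming from row
    [i] of [A] has the same absolute sum as that row ([fuzzy_S_row_sum]).  Only
    the place of the large entry can change: both rows contain [A i i], on the
    diagonal of [S] if [A i i] is positive, and otherwise in the column of the
    twin row.  Exchanging the twin rows [i] and [n + i] exactly when [A i i] is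
    not positive therefore puts every dominant entry on the diagonal
    ([fuzzy_S_align_diag]).  When the diagonal of [A] is positive this
    permutation of the rows is the identity, so (b) is a case of (a). *)

Lemma strictly_diag_dominantE {R : realType} {k : nat} (B : 'M[R]_k) :
  strictly_diag_dominant B <->
  (forall i, \sum_j `|B i j| < `|B i i| *+ 2).
Proof.
by split=> domB i; have := domB i;
  rewrite [X in X < _ *+ 2](bigD1 i) //= mulr2n ltrD2l.
Qed.

Definition twin {n : nat} (k : 'I_(n + n)) : 'I_(n + n) :=
  match split k with inl i => rshift n i | inr i => lshift n i end.

Definition base {n : nat} (k : 'I_(n + n)) : 'I_n :=
  match split k with inl i => i | inr i => i end.

Lemma twin_lshift {n : nat} (i : 'I_n) : twin (lshift n i) = rshift n i.
Proof. by rewrite /twin (unsplitK (inl i)). Qed.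

Lemma twin_rshift {n : nat} (i : 'I_n) : twin (rshift n i) = lshift n i.
Proof. by rewrite /twin (unsplitK (inr i)). Qed.

Lemma base_lshift {n : nat} (i : 'I_n) : base (lshift n i) = i.
Proof. by rewrite /base (unsplitK (inl i)). Qed.

Lemma base_rshift {n : nat} (i : 'I_n) : base (rshift n i) = i.
Proof. by rewrite /base (unsplitK (inr i)). Qed.

Definition baseE := (@base_lshift, @base_rshift).
Definition twinE := (@twin_lshift, @twin_rshift).

Lemma twinK {n : nat} : involutive (@twin n).
Proof. by move=> k; case: (split_ordP k) => i ->; rewrite !twinE. Qed.

Lemma base_twin {n : nat} (k : 'I_(n + n)) : base (twin k) = base k.
Proof. by case: (split_ordP k) => i ->; rewrite twinE !baseE. Qed.

(** The row of [S] in which column [k] contains the diagonal entry of [A]. *)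
Definition align {R : realType} {n : nat} (A : 'M[R]_n) (k : 'I_(n + n)) :
    'I_(n + n) :=
  if 0 < A (base k) (base k) then k else twin k.

Lemma base_align {R : realType} {n : nat} (A : 'M[R]_n) (k : 'I_(n + n)) :
  base (align A k) = base k.
Proof. by rewrite /align; case: ifP => // _; rewrite base_twin. Qed.

(** Twin indices have the same base, so they are both fixed or exchanged. *)
Lemma alignK {R : realType} {n : nat} (A : 'M[R]_n) : involutive (align A).
Proof.
move=> k; rewrite {1}/align base_align /align.
by case: (0 < _) => //; rewrite twinK.
Qed.

Lemma normr_fuzzy_split {R : realType} {n : nat} (A : 'M[R]_n) (i j : 'I_n) :
  `|fuzzy_S1 A i j| + `|fuzzy_S2 A i j| = `|A i j|.
Proof.
by rewrite !mxE; case: ifP => _; rewrite ?subrr ?subr0 normr0 ?addr0 ?add0r.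
Qed.

Lemma fuzzy_S_row_sum {R : realType} {n : nat} (A : 'M[R]_n) (k : 'I_(n + n)) :
  \sum_j `|fuzzy_S A k j| = \sum_j `|A (base k) j|.
Proof.
rewrite big_split_ord /= -big_split /=; apply: eq_bigr => j _.
rewrite -(normr_fuzzy_split A) /fuzzy_S; case: (split_ordP k) => i ->.
  by rewrite block_mxEul block_mxEur baseE.
by rewrite block_mxEdl block_mxEdr baseE addrC.
Qed.

Lemma fuzzy_S_align_diag {R : realType} {n : nat} (A : 'M[R]_n)
    (k : 'I_(n + n)) :
  fuzzy_S A (align A k) k = A (base k) (base k).
Proof.
rewrite /align /fuzzy_S.
case: (split_ordP k) => i ->; rewrite baseE; case: ifP => Aii; rewrite ?twinE.
- by rewrite block_mxEul mxE Aii.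
- by rewrite block_mxEdl !mxE Aii subr0.
- by rewrite block_mxEdr mxE Aii.
- by rewrite block_mxEur !mxE Aii subr0.
Qed.

Lemma row_perm_align_dominant {R : realType} {n : nat} (A : 'M[R]_n) :
  strictly_diag_dominant A ->
  strictly_diag_dominant
    (row_perm (perm (inv_inj (alignK A))) (fuzzy_S A)).
Proof.
move=> /strictly_diag_dominantE domA; apply/strictly_diag_dominantE => k.
under eq_bigr do rewrite mxE permE.
by rewrite mxE permE fuzzy_S_align_diag fuzzy_S_row_sum base_align.
Qed.

Theorem corollary2 (R : realType) (n : nat) (A : 'M[R]_n) :
  (strictly_diag_dominant A ->
     exists P : 'M[R]_(n + n),
       is_perm_mx P /\ strictly_diag_dominant (P *m fuzzy_S A)) /\
  (strictly_diag_dominant A -> (forall i : 'I_n, 0 < A i i) ->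
     strictly_diag_dominant (fuzzy_S A)).
Proof.
split=> [domA | domA A_gt0].
  exists (perm_mx (perm (inv_inj (alignK A)))).
  split; first exact: perm_mx_is_perm.
  by rewrite -row_permE; apply: row_perm_align_dominant.
have := row_perm_align_dominant A domA.
suff -> : perm (inv_inj (alignK A)) = 1%g by rewrite row_perm1.
by apply/permP => k; rewrite permE perm1 /align A_gt0.
Qed.
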